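(* Let $k\ge 1$ be an integer, let $A$ be a finite set of real numbers and let $f:\mathbb{R}\to\mathbb{R}$ be a $k$-convex function. Suppose $K>0$ satisfies $|A+A-A|\le K|A|$. Then \[ |2^kf(A)-(2^k-1)f(A)| \gg_k \frac{|A|^{2^{k+1}-1}}{|A+A-A|^{2^{k+1}-k-2}} \;\ge\; |A|^{k+1}K^{-(2^{k+1}-k-2)}. \]
   Context: A function $f:\mathbb{R}\to\mathbb{R}$ of class $C^k$ is called $k$-convex if each of $f^{(0)}=f, f^{(1)},\dots,f^{(k)}$ is strictly monotone (each either strictly increasing or strictly decreasing). For a set $X\subseteq\mathbb{R}$ and nonnegative integers $m,n$, $mX-nX$ denotes $\{x_1+\dots+x_m-y_1-\dots-y_n: x_i,y_j\in X\}$; $f(A)=\{f(a):a\in A\}$ and $A+A-A=\{a+a'-a'':a,a',a''\in A\}$. The notation $X\gg_k Y$ means $X\ge c(k)Y$ for a constant $c(k)>0$ depending only on $k$. *)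

(* Defs.v *)
From mathcomp Require Import all_boot all_order all_algebra finmap.
From mathcomp Require Import boolp classical_sets reals topology normedtype derive.

Set Implicit Arguments.
Unset Strict Implicit.
Unset Printing Implicit Defensive.

Import Order.TTheory GRing.Theory Num.Theory.
Import numFieldNormedType.Exports.

Local Open Scope ring_scope.
Local Open Scope classical_set_scope.


(* [f^`(j)] is total (junk where the derivative does not exist), so the
   existence of the derivatives of order [<= k] is required explicitly. *)
Definition class_C (R : realType) (k : nat) (f : R -> R) : Prop :=
  (forall j : nat, (j < k)%N -> forall x : R, derivable f^`(j) x 1) /\
  continuous f^`(k).

Definition strictly_monotone (R : realType) (g : R -> R) : Prop :=
  (forall x y : R, x < y -> g x < g y) \/
  (forall x y : R, x < y -> g y < g x).

Definition k_convex (R : realType) (k : nat) (f : R -> R) : Prop :=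
  class_C k f /\ (forall j : nat, (j <= k)%N -> strictly_monotone f^`(j)).

(* m X - n X *)
Definition sumdiff (R : realType) (m n : nat) (X : {fset R}) : {fset R} :=
  [fset \sum_(a <- x) val a - \sum_(b <- y) val b
     | x : m.-tuple X in predT, y : n.-tuple X in predT]%fset.

(* A + A - A *)
Definition addsub (R : realType) (A : {fset R}) : {fset R} :=
  [fset (s - a'')%R | s in [fset (a + a')%R | a in A, a' in A], a'' in A]%fset.

(* Main.v *)
(* Induction on k, keeping all the elements that are produced inside the convex hull
   of f(A).  Assume f increasing, and write d_a for the gap from a to its successor in
   A.  The points a + d with d <= d_a a gap lie in disjoint intervals and in A + A - A,
   so d_a is among the O(|A+A-A| / |A|) smallest gaps for most a.  For most of these a,
   the set B_a of the b having the same gap d as a, and at which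
   f_d(x) = f(x + d) - f(x) is at most f_d(a), has at least a constant times
   |A|^2 / |A+A-A| elements.  By induction applied to f_d and B_a, the hull of
   f_d(B_a), a subset of (0, f_d(a)], contains many sums; translated by f(a), they fall
   into the disjoint intervals (f(a), f(a + d_a)], hence can be added up. *)

Require Import Defs.
From mathcomp Require Import all_boot all_order all_algebra finmap.
From mathcomp Require Import boolp classical_sets reals topology normedtype derive.
From mathcomp Require Import ring lra zify.
Import Order.TTheory GRing.Theory Num.Theory.
Import numFieldNormedType.Exports.
Local Open Scope ring_scope.

(** * Monotonicity of iterated differences *)

Lemma is_derive_translate (R : realType) (f : R -> R) (d x : R) :
  derivable f (x + d) 1 ->
  is_derive x 1 (fun y => f (y + d)) (derive1 f (x + d)).
Proof.
move=> df.
have E : (fun h : R => h^-1 *: (((fun y => f (y + d)) \o shift x) (h *: 1) - f (x + d)))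
    = (fun h : R => h^-1 *: ((f \o shift (x + d)) (h *: 1) - f (x + d))).
  by apply: funext => h /=; rewrite addrA.
have df' : derivable (fun y => f (y + d)) x 1 by rewrite /derivable E.
apply: DeriveDef => //.
by rewrite derive1E /derive E.
Qed.

Lemma is_derive_difference (R : realType) (f : R -> R) (d x : R) :
  (forall y : R, derivable f y 1) ->
  is_derive x 1 (fun y => f (y + d) - f y) (derive1 f (x + d) - derive1 f x).
Proof.
move=> df; apply: is_deriveB; first exact: is_derive_translate.
by rewrite derive1E; apply: derivableP.
Qed.

Lemma derive1n_difference (R : realType) (f : R -> R) (d : R) (k j : nat) :
  (forall i, (i < k)%N -> forall x : R, derivable (derive1n i f) x 1) ->
  (j <= k)%N ->
  derive1n j (fun y => f (y + d) - f y)
    = (fun y => derive1n j f (y + d) - derive1n j f y).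
Proof.
move=> df; elim: j => [//|j IH] jk.
rewrite !derive1nS IH; last exact: ltnW.
apply: funext => x; rewrite derive1E.
by have [_ ->] := @is_derive_difference R _ d x (df j jk).
Qed.

(** By the mean value theorem the difference changes between [x] and [y] by
    [(f'(z + d) - f'(z)) (y - x)], whose sign is fixed by the monotonicity of [f']. *)
Lemma strictly_monotone_difference (R : realType) (f : R -> R) (d : R) :
  0 < d -> (forall x : R, derivable f x 1) -> strictly_monotone (derive1 f) ->
  strictly_monotone (fun y => f (y + d) - f y).
Proof.
move=> d0 df mf'.
have mvt (x y : R) : x < y -> exists z, (f (y + d) - f y) - (f (x + d) - f x)
    = (derive1 f (z + d) - derive1 f z) * (y - x).
  move=> xy.
  have [||z _ ->] := @MVT R (fun y => f (y + d) - f y)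
      (fun y => derive1 f (y + d) - derive1 f y) x y xy.
  - by move=> z _; apply: is_derive_difference.
  - apply: derivable_within_continuous => z _.
    by have [] := @is_derive_difference R f d z df.
  - by exists z.
case: mf' => mf'; [left|right] => x y xy; have [z E] := mvt _ _ xy;
  have zd : z < z + d by rewrite ltrDl.
- rewrite -subr_gt0 E mulr_gt0 ?subr_gt0 //; exact: mf'.
- rewrite -subr_lt0 E nmulr_rlt0 ?subr_gt0 // subr_lt0; exact: mf'.
Qed.

(* What the counting argument uses of [k]-convexity: monotonicity of [f] and of
   its iterated differences with positive steps. *)
Fixpoint difference_convex {R : realType} (k : nat) (f : R -> R) : Prop :=
  strictly_monotone f /\
  if k is k'.+1 then
    forall d : R, 0 < d -> difference_convex k' (fun x => f (x + d) - f x)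
  else True.

(** Differences commute with derivatives, so each difference costs one derivative: monotonicity at
    order [j] for the difference comes from order [j + 1] for [f]. *)
Lemma difference_convex_derivable (R : realType) (k : nat) (f : R -> R) :
  (forall j, (j < k)%N -> forall x : R, derivable (derive1n j f) x 1) ->
  (forall j, (j <= k)%N -> strictly_monotone (derive1n j f)) ->
  difference_convex k f.
Proof.
elim: k f => [|k IH] f df mf; first by split=> //; apply: (mf 0%N).
split; first exact: (mf 0%N).
move=> d d0; apply: IH => j jk.
  move=> x; rewrite (derive1n_difference _ _ d k.+1) //; last exact/ltnW/ltnW.
  by have [] := @is_derive_difference R _ d x (df j (ltnW jk)).
rewrite (derive1n_difference _ _ d k.+1) //; last exact: leqW.
by apply: strictly_monotone_difference; rewrite // -?derive1nS; [apply: df|apply: mf].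
Qed.

Lemma strictly_monotoneN (R : realType) (f : R -> R) :
  strictly_monotone f -> strictly_monotone (fun x => - f x).
Proof. by case=> mf; [right|left] => x y /mf; rewrite ltrN2. Qed.

Lemma difference_convexN (R : realType) (k : nat) (f : R -> R) :
  difference_convex k f -> difference_convex k (fun x => - f x).
Proof.
elim: k f => [|k IH] f [mf df]; split=> //; try exact: strictly_monotoneN.
move=> d d0; have := IH _ (df d d0).
by congr difference_convex; apply: funext => x; rewrite opprB opprK addrC.
Qed.

(** * Ranks, disjoint unions and counting in finite sequences *)

Lemma seq_argmax (R : realDomainType) (T : eqType) (h : T -> R) (s : seq T) :
  s != [::] -> exists2 x, x \in s & forall y, y \in s -> h y <= h x.
Proof.
elim: s => [//|a [|b s] IH] _.
  by exists a; rewrite ?inE // => y; rewrite inE => /eqP->.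
have [//|x xs hx] := IH.
have [ax|xa] := leP (h a) (h x).
  exists x; first by rewrite inE xs orbT.
  by move=> y; rewrite inE => /orP[/eqP->//|/hx].
exists a; first by rewrite inE eqxx.
move=> y; rewrite inE => /orP[/eqP->//|/hx yx]; exact: le_trans yx (ltW xa).
Qed.

(** All selected elements lie below the selected one with the largest [h], so their number is at
    most its rank. *)
Lemma size_low_rank (R : realDomainType) (T : eqType) (h : T -> R) (s : seq T) (tau : R) :
  0 <= tau ->
  (size [seq x <- s | (count (fun y => h y <= h x) s)%:R <= tau])%:R <= tau.
Proof.
move=> tau0; set Y := seq.filter _ s.
have [->//|Y0] := eqVneq Y nil.
have [x xY hx] := seq_argmax _ _ h Y Y0.
move: (xY); rewrite mem_filter => /andP[xt xs].
apply: le_trans xt; rewrite ler_nat.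
have -> : size Y = count (fun y => h y <= h x) Y.
  by apply/esym/eqP; rewrite -all_count; apply/allP => y /hx.
by rewrite /Y count_filter; apply: sub_count => y /= /andP[].
Qed.

Lemma uniq_flatten_disjoint (I T : eqType) (s : seq I) (t : I -> seq T) :
  uniq s -> {in s, forall x, uniq (t x)} ->
  {in s &, forall x y, x != y -> forall z, z \in t x -> z \notin t y} ->
  uniq (flatten (map t s)).
Proof.
elim: s => [//|a s IH] /= /andP[as_ us] ut dt.
rewrite cat_uniq ut ?inE ?eqxx //= IH //; first last.
- by move=> x y xs ys; apply: dt; rewrite inE ?xs ?ys orbT.
- by move=> x xs; apply: ut; rewrite inE xs orbT.
rewrite andbT; apply/hasPn => z /flattenP[_ /mapP[y ys ->] zy].
apply: dt zy; rewrite ?inE ?eqxx ?ys ?orbT //.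
by apply: contraNneq as_ => <-.
Qed.

(** The intervals [(lo x, hi x]] may touch, but being open on the left they stay disjoint. *)
Lemma uniq_flatten_intervals (R S : realDomainType) (s : seq S) (lo hi : S -> R)
    (t : S -> seq R) :
  uniq s -> {in s, forall x, uniq (t x)} ->
  {in s &, forall x y, x < y -> hi x <= lo y} ->
  {in s, forall x, {in t x, forall z, lo x < z <= hi x}} ->
  uniq (flatten (map t s)).
Proof.
move=> us ut hlP tP; apply: uniq_flatten_disjoint => // x y xs ys xy z zx.
apply/negP => zy; have /andP[xz zhx] := tP x xs z zx.
have /andP[yz zhy] := tP y ys z zy.
have [/(hlP _ _ xs ys) h|/(hlP _ _ ys xs) h|e] := ltgtP x y.
- by have := lt_le_trans yz (le_trans zhx h); rewrite ltxx.
- by have := lt_le_trans xz (le_trans zhy h); rewrite ltxx.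
- by rewrite e eqxx in xy.
Qed.

Lemma size_flatten_map (I T : Type) (s : seq I) (t : I -> seq T) :
  size (flatten (map t s)) = (\sum_(x <- s) size (t x))%N.
Proof.
by rewrite size_flatten /shape -map_comp sumnE big_map.
Qed.

Lemma count_fibers (T S : eqType) (g : T -> S) (P : pred T) (s : seq T) (L : seq S) :
  (count (fun a => (g a \in L) && P a) s
    <= \sum_(d <- L) count (fun a => (g a == d) && P a) s)%N.
Proof.
elim: L => [|d L IH]; first by rewrite big_nil (eq_count (a2 := pred0)) ?count_pred0.
rewrite big_cons; apply: leq_trans (leq_add (leqnn _) IH).
rewrite -count_predUI; apply: leq_trans (leq_addr _ _).
by apply: sub_count => a /=; rewrite inE andb_orl.
Qed.

Lemma count_markov (R : realDomainType) (T : Type) (w : T -> nat) (s : seq T) (lam : R) :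
  (count (fun a => lam < (w a)%:R) s)%:R * lam <= (\sum_(a <- s) w a)%N%:R.
Proof.
elim: s => [|a s IH]; first by rewrite mul0r big_nil.
rewrite big_cons /= !natrD mulrDl lerD //.
by case: ltP => [/ltW|_] /=; rewrite ?mul1r ?mul0r.
Qed.

(** [A'] omits only the maximum of [A], which has no successor. The induction runs over a sorted
    copy, the new head [x] getting the old head [y] as successor. *)
Lemma exists_successor (R : realDomainType) (A : seq R) :
  uniq A -> (0 < size A)%N ->
  exists A' nx, [/\ uniq A', (size A').+1 = size A,
    {in A', forall a, [/\ a \in A, nx a \in A & a < nx a]} &
    {in A' &, forall a b : R, a < b -> nx a <= b}].
Proof.
move=> uA; rewrite -(size_sort <=%O).
have mA : sort <=%O A =i A by apply: mem_sort.
have sA : sorted <%O (sort <=%O A) by rewrite sort_lt_sorted.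
suff H s : sorted <%O s -> (0 < size s)%N -> exists A' nx, [/\ uniq A',
    (size A').+1 = size s,
    {in A', forall a : R, [/\ a \in s, nx a \in s & a < nx a]} &
    {in A' &, forall a b : R, a < b -> nx a <= b}].
  move=> /(H _ sA)[A' [nx [u sz h1 h2]]]; exists A', nx; split=> //.
  by move=> a /h1; rewrite !mA.
elim: s {uA mA sA} => [//|x [|y s] IH] xs _.
  by exists [::], id.
have /andP[xy ys] : (x < y) && sorted <%O (y :: s) by [].
have [//|//|A' [nx [uA' sz h1 h2]]] := IH.
have yA a : a \in y :: s -> y <= a.
  rewrite inE => /orP[/eqP->//|a_s].
  by have /allP/(_ _ a_s)/ltW := order_path_min lt_trans ys.
have xA' : x \notin A'.
  by apply: contraTN xy => /h1[/yA h _ _]; rewrite -leNgt.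
exists (x :: A'), (fun z => if z == x then y else nx z); split.
- by rewrite /= xA'.
- by rewrite /= sz.
- move=> a; rewrite inE; case: eqVneq => [->|ax] /=.
    by move=> _; rewrite !inE !eqxx orbT.
  by move=> /h1[h h' h'']; rewrite inE h orbT inE h' orbT.
- move=> a b; rewrite !inE; case: (eqVneq a x) => [->|ax] /= + /orP[/eqP->|bA].
  + by rewrite ltxx.
  + by move=> _ _; apply: yA; have [] := h1 _ bA.
  + move=> aA ax'; have [/yA ya _ _] := h1 _ aA.
    by have := lt_le_trans (lt_trans ax' xy) ya; rewrite ltxx.
  + by move=> aA; apply: h2.
Qed.

(** * Signed sums of values and the inductive statement *)

(** The terms are indexed by points of [A] rather than by elements of the image, so that a value of
    a difference function can be split into values of [f] at [x + d] and [x]. *)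
Definition in_sumdiff {R : zmodType} (m n : nat) (f : R -> R) (A : seq R) (s : R) :=
  exists xs ys : seq R, [/\ size xs = m, size ys = n, {subset xs <= A},
    {subset ys <= A} & s = \sum_(x <- xs) f x - \sum_(y <- ys) f y].

Lemma in_sumdiffN (R : zmodType) (m n : nat) (f : R -> R) (A : seq R) (s : R) :
  in_sumdiff m n (fun x => - f x) A s -> in_sumdiff m n f A (- s).
Proof.
move=> [xs [ys [sx sy hx hy ->]]]; exists xs, ys; split=> //.
by rewrite !sumrN opprB opprK addrC.
Qed.

Lemma in_sumdiff_self (R : zmodType) (n : nat) (f : R -> R) (A : seq R) (a : R) :
  a \in A -> in_sumdiff n.+1 n f A (f a).
Proof.
move=> aA; exists (nseq n.+1 a), (nseq n a); rewrite !size_nseq; split=> //.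
- by move=> x; rewrite mem_nseq => /andP[_ /eqP->].
- by move=> x; rewrite mem_nseq => /andP[_ /eqP->].
- by rewrite /= big_cons addrK.
Qed.

(** Each of the [m + n] differences supplies one added and one subtracted value of [f], and [f a] is
    one more added value. With [m = 2^k] and [n = 2^k - 1] this is the passage from [k] to
    [k + 1]. *)
Lemma in_sumdiff_difference (R : zmodType) (m n : nat) (f : R -> R) (A B : seq R)
    (a d s : R) :
  a \in A -> {in B, forall b, b \in A /\ b + d \in A} ->
  in_sumdiff m n (fun x => f (x + d) - f x) B s ->
  in_sumdiff (m + n).+1 (m + n) f A (f a + s).
Proof.
move=> aA BA [xs [ys [sx sy hx hy ->]]].
exists (a :: [seq x + d | x <- xs] ++ ys), (xs ++ [seq y + d | y <- ys]); split.
- by rewrite /= size_cat size_map sx sy.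
- by rewrite size_cat size_map sx sy.
- move=> x; rewrite inE mem_cat => /or3P[/eqP->//|/mapP[z /hx/BA[_ zA] ->//]|/hy/BA[]//].
- move=> x; rewrite mem_cat => /orP[/hx/BA[]//|/mapP[z /hy/BA[_ zA] ->//]].
- rewrite big_cons !big_cat !big_map /= !sumrB.
  set s1 := \sum_(i <- xs) f (i + d); set s2 := \sum_(i <- xs) f i.
  set s3 := \sum_(i <- ys) f (i + d); set s4 := \sum_(i <- ys) f i.
  by rewrite opprB opprD -!addrA; congr (_ + (_ + _)); rewrite [RHS]addrCA.
Qed.

(* Confining [S] to the convex hull of [f(A)] is what lets the induction hypothesis
   for several difference functions be added up without overlaps. *)
Definition squeezed {R : realType} (k : nat) (c : R) (f : R -> R) (A T : seq R) :=
  exists S : seq R, [/\ uniq S,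
    {in S, forall s, in_sumdiff (2 ^ k) (2 ^ k - 1) f A s},
    {in S, forall s, (exists2 a, a \in A & f a <= s) /\ (exists2 a, a \in A & s <= f a)} &
    c * (size A)%:R ^+ (2 ^ k.+1 - 1)
      <= (size S)%:R * (size T)%:R ^+ (2 ^ k.+1 - k - 2)].

(** An inclusion rather than an equality, so that one fixed [T] also serves the subsets of [A] met
    in the induction. *)
Definition addsub_sub {R : zmodType} (A T : seq R) :=
  {in A & &, forall a b d : R, a + b - d \in T}.

(** Reduces a decreasing [f] to an increasing one; negating the sums exchanges the two hull
    bounds. *)
Lemma squeezedN {R : realType} (k : nat) (c : R) (f : R -> R) (A T : seq R) :
  squeezed k c (fun x => - f x) A T -> squeezed k c f A T.
Proof.
move=> [S [uS hS hullS cS]]; exists [seq - s | s <- S]; split.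
- by rewrite map_inj_uniq //; apply: oppr_inj.
- by move=> _ /mapP[s /hS hs ->]; apply: in_sumdiffN.
- move=> _ /mapP[s /hullS[[a aA ha] [b bA hb]] ->]; split.
    by exists b; rewrite // lerNr.
  by exists a; rewrite // lerNl.
- by rewrite size_map.
Qed.

(** * The induction on [k] *)

Lemma squeezed_step (R : realType) (k : nat) (c : R) (f : R -> R) (A T : seq R) :
  0 < c -> c <= 1 ->
  (forall (g : R -> R) (B : seq R), difference_convex k g -> uniq B -> addsub_sub B T ->
    squeezed k c g B T) ->
  difference_convex k.+1 f -> (forall x y : R, x < y -> f x < f y) ->
  uniq A -> addsub_sub A T ->
  squeezed k.+1 (c / (4 * 64 ^+ (2 ^ k.+1 - 1))) f A T.
Proof.
move=> c0 c1 IH [_ df] mf uA AT.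
(* The exponents at [k]; at [k + 1] they become [2E + 1] and [E + F]. *)
set E := (2 ^ k.+1 - 1)%N; set F := (2 ^ k.+1 - k - 2)%N.
have k2 : (k + 2 <= 2 ^ k.+1)%N by have := @ltn_expl 2 k.+1 isT; lia.
have EE : (2 ^ k.+2 - 1 = (E + E).+1)%N by rewrite /E (expnS 2 k.+1); lia.
have FE : (2 ^ k.+2 - k.+1 - 2 = E + F)%N by rewrite /E /F (expnS 2 k.+1); lia.
have c'1 : c / (4 * 64 ^+ E) <= 1.
  rewrite ler_pdivrMr ?mul1r; last by rewrite mulr_gt0 ?exprn_gt0.
  by apply: le_trans c1 _; rewrite mulr_ege1 ?exprn_ege1 // ler1n.
case: (posnP (size A)) => [A0|A_gt0].
  exists [::]; split=> //.
  by rewrite A0 EE exprS mul0r mulr0 mul0r.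
have [a0 a0A] : exists a0, a0 \in A by case: (A) A_gt0 => // a0 l _; exists a0; rewrite inE eqxx.
have T_gt0 : (0 < size T)%N.
  by have := AT _ _ _ a0A a0A a0A; case: (T).
(* A singleton has no gap, and [n] below would vanish. The single sum [f a0] suffices, as the
   constant is at most 1 and [T] is nonempty. *)
have [A_le1|A_gt1] := leqP (size A) 1.
  exists [:: f a0]; split=> //.
  - move=> _ /[1!inE]/eqP->; rewrite -[X in in_sumdiff X _](@subnK 1) ?expn_gt0 // addn1.
    exact: in_sumdiff_self.
  - by move=> _ /[1!inE]/eqP->; split; exists a0.
  - have -> : size A = 1%N by lia.
    by rewrite expr1n mulr1 mul1r (le_trans c'1) // exprn_ege1 // ler1n.
have [A' [nx [uA' sA' hA' hnx]]] := exists_successor _ _ uA A_gt0.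
set g := fun a => nx a - a.
have gE a : a + g a = nx a by rewrite /g addrC subrK.
have g0 a : a \in A' -> 0 < g a by move=> /hA'[_ _]; rewrite subr_gt0.
set G := undup (map g A').
have uG : uniq G by apply: undup_uniq.
set rk := fun d => count (fun d' => d' <= d) G.
pose n : R := (size A')%:R; pose D : R := (size T)%:R; pose N : R := (size A)%:R.
have n0 : 0 < n by rewrite /n ltr0n -ltnS sA'.
have D0 : 0 < D by rewrite ltr0n.
have nN : N <= 2 * n by rewrite /N /n -natrM ler_nat -sA' mul2n -addnn -add1n leq_add2r -ltnS sA'.
have sum_rk : (\sum_(a <- A') rk (g a))%N%:R <= D.
  rewrite ler_nat.
  set t := fun a => [seq a + d | d <- [seq d <- G | d <= g a]].
  have -> : (\sum_(a <- A') rk (g a) = size (flatten (map t A')))%N.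
    by rewrite size_flatten_map; apply: eq_bigr => a _; rewrite size_map size_filter.
  apply: uniq_leq_size.
    apply: (uniq_flatten_intervals _ _ _ id nx) => // x xA'.
      by rewrite map_inj_uniq ?filter_uniq //; apply: addrI.
    move=> _ /mapP[d + ->]; rewrite mem_filter mem_undup => /andP[dx /mapP[b bA' db]].
    by rewrite ltrDl db g0 //= -db -(gE x) lerD2l.
  move=> _ /flattenP[_ /mapP[a /hA'[aA _ _] ->] /mapP[d + ->]].
  rewrite mem_filter mem_undup => /andP[_ /mapP[b /hA'[bA nbA _] ->]].
  by rewrite /g addrA; apply: AT.
(* The thresholds are balanced: by Markov's inequality [lam] loses at most [n / 4] points, and
   [lam * tau = n / 4] bounds the second loss. *)
pose lam := 4 * D / n; pose tau := n ^+ 2 / (16 * D).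
have lam0 : 0 < lam by rewrite divr_gt0 ?mulr_gt0.
have tau0 : 0 < tau by rewrite divr_gt0 ?mulr_gt0 ?exprn_gt0.
set L := [seq d <- G | (rk d)%:R <= lam].
have sL : (size L)%:R <= lam by apply: size_low_rank; apply: ltW.
pose B a := [seq b <- A' | (g b == g a) && (f (b + g a) - f b <= f (a + g a) - f a)].
set Good := [seq a <- A' | (g a \in L) && (tau <= (size (B a))%:R)].
have bad1 : (count (fun a => lam < (rk (g a))%:R) A')%:R <= n / 4.
  have := le_trans (count_markov _ _ (fun a => rk (g a)) A' lam) sum_rk.
  rewrite -ler_pdivlMr // => /le_trans; apply.
  by rewrite /lam invf_div mulrA [D * n]mulrC -mulf_div divff ?gt_eqF // mulr1.
(* Among the points with gap [d], the size of [B a] is the rank of [a] for the difference function.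
   So at most [tau] of them have rank below [tau], for each of the at most [lam] gaps in [L]. *)
have bad2 : (count (fun a => (g a \in L) && ((size (B a))%:R < tau)) A')%:R <= n / 4.
  set P := fun a => (size (B a))%:R < tau.
  apply: (@le_trans _ _ (\sum_(d <- L) count (fun a => (g a == d) && P a) A')%N%:R).
    by rewrite ler_nat; apply: count_fibers.
  rewrite natr_sum.
  apply: (@le_trans _ _ (\sum_(d <- L) tau)).
    apply: ler_sum => d _; rewrite -size_filter.
    set Ad := [seq a <- A' | g a == d].
    have := size_low_rank _ _ (fun a => f (a + d) - f a) Ad tau (ltW tau0).
    apply: le_trans; rewrite ler_nat !size_filter /Ad count_filter.
    apply: sub_count => a /= /andP[/eqP gad Ba]; rewrite gad eqxx andbT.
    apply: le_trans (ltW Ba); rewrite ler_nat /B size_filter count_filter gad.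
    by apply: sub_count => b /=; rewrite andbC.
  rewrite big_const_seq count_predT iter_addr addr0 -[tau *+ _]mulr_natl.
  apply: le_trans (ler_wpM2r (ltW tau0) sL) _.
  rewrite /lam /tau le_eqVlt; apply/orP; left; apply/eqP.
  by field; rewrite !gt_eqF.
have sGood : n / 2 <= (size Good)%:R.
  have h : n <= (size Good)%:R + ((count (fun a => lam < (rk (g a))%:R) A')%:R
     + (count (fun a => (g a \in L) && ((size (B a))%:R < tau)) A')%:R).
    rewrite -!natrD ler_nat /Good size_filter.
    rewrite -(count_predC (fun a => (g a \in L) && (tau <= (size (B a))%:R))) leq_add2l.
    rewrite -count_predUI; apply: leq_trans (leq_addr _ _).
    rewrite -!size_filter; apply: uniq_leq_size; first by rewrite filter_uniq.
    move=> a; rewrite !mem_filter /= negb_and -ltNge => /andP[+ aA']; rewrite aA' andbT.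
    have gG : g a \in G by rewrite mem_undup map_f.
    by rewrite /L mem_filter gG andbT [lam < _]ltNge; case: (_ <= lam).
  lra.
have hB a b : b \in B a -> [/\ b \in A', g b = g a &
    f (b + g a) - f b <= f (a + g a) - f a].
  by rewrite mem_filter => /andP[/andP[/eqP-> ->] ->].
(* The condition on [a] sits under the existential so that choice yields a total function. *)
have exS a : exists Sa : seq R, a \in A' -> [/\ uniq Sa,
    {in Sa, forall s, in_sumdiff (2 ^ k) (2 ^ k - 1) (fun x => f (x + g a) - f x) (B a) s},
    {in Sa, forall s, (exists2 b, b \in B a & f (b + g a) - f b <= s) /\
       (exists2 b, b \in B a & s <= f (b + g a) - f b)} &
    c * (size (B a))%:R ^+ E <= (size Sa)%:R * D ^+ F].
  have [aA'|aA'] := boolP (a \in A'); last by exists [::].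
  have [||| Sa hSa] := IH (fun x => f (x + g a) - f x) (B a).
  - exact/df/g0.
  - by rewrite filter_uniq.
  - by move=> x y z /hB[/hA'[xA _ _] _ _] /hB[/hA'[yA _ _] _ _] /hB[/hA'[zA _ _] _ _]; apply: AT.
  - by exists Sa.
have [S hS] := boolp.choice exS.
pose t a := [seq f a + s | s <- S a].
(* The hull is bounded below by a difference that is positive because [f] increases, and above by
   [f (nx a) - f a] through the second condition in [B a]. *)
have tP a : a \in A' -> {in t a, forall z, f a < z <= f (nx a)}.
  move=> aA' _ /mapP[s sS ->]; have [_ _ hull _] := hS a aA'.
  have [[b bB bs] [b' b'B b's]] := hull s sS; apply/andP; split.
    rewrite ltrDl; apply: lt_le_trans bs; rewrite subr_gt0; apply: mf.
    by rewrite ltrDl g0.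
  have [_ _ h] := hB _ _ b'B.
  by rewrite -(gE a) addrC -lerBrDr (le_trans b's).
have GA' a : a \in Good -> a \in A' by rewrite mem_filter => /andP[].
exists (flatten (map t Good)); split.
- apply: (uniq_flatten_intervals _ _ _ f (f \o nx)) => /=.
  + by rewrite filter_uniq.
  + by move=> a /GA' aA'; rewrite map_inj_uniq; [case: (hS a aA')|apply: addrI].
  + move=> a b /GA' aA' /GA' bA' ab; have := hnx _ _ aA' bA' ab.
    by rewrite le_eqVlt => /orP[/eqP->//|/mf/ltW].
  + by move=> a /GA' aA'; apply: tP.
- move=> _ /flattenP[_ /mapP[a /GA' aA' ->] /mapP[s sS ->]].
  have [_ h _ _] := hS a aA'; have [aA _ _] := hA' a aA'.
  have -> : (2 ^ k.+1 = (2 ^ k + (2 ^ k - 1)).+1)%N.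
    by rewrite addnBA ?expn_gt0 // addnn -mul2n -expnS subn1 prednK ?expn_gt0.
  rewrite subSS subn0.
  apply: in_sumdiff_difference (h s sS) => // b /hB[/[dup]/hA'[bA nbA _] _ <- _].
  by rewrite gE.
- move=> z /flattenP[_ /mapP[a /GA' aA' ->] zt].
  have /andP[/ltW za zn] := tP a aA' z zt; have [aA naA _] := hA' a aA'.
  by split; [exists a|exists (nx a)].
- rewrite EE FE size_flatten_map -/N -/D.
  have main a : a \in Good -> c * tau ^+ E <= (size (t a))%:R * D ^+ F.
    rewrite mem_filter size_map => /andP[/andP[_ tauB] /hS[_ _ _]]; apply: le_trans.
    by rewrite ler_wpM2l ?(ltW c0) // lerXn2r ?nnegrE ?(ltW tau0).
  have sum_main : (size Good)%:R * (c * tau ^+ E)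
      <= (\sum_(a <- Good) size (t a))%N%:R * D ^+ F.
    rewrite natr_sum mulr_suml mulr_natl -[X in X <= _]addr0 -iter_addr.
    rewrite -[X in iter X](count_predT) -big_const_seq big_seq [leRHS]big_seq.
    exact: ler_sum.
  rewrite exprD mulrA [X in _ <= X]mulrAC.
  apply: le_trans (ler_wpM2r (exprn_ge0 _ (ltW D0)) sum_main).
  apply: (@le_trans _ _ (n / 2 * (c * tau ^+ E) * D ^+ E)); last first.
    by rewrite !ler_wpM2r ?mulr_ge0 ?exprn_ge0 ?(ltW D0) ?(ltW c0) ?(ltW tau0).
  (* The 64 combines the 16 in [tau] with [N <= 2 * n]. *)
  have N4 : N ^+ 2 / 64 <= tau * D.
    have -> : tau * D = n ^+ 2 / 16 by rewrite /tau; field; rewrite gt_eqF.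
    have : 0 <= N by [].
    by nra.
  (* One factor [N] is matched with the number of good points, at least [n / 2 >= N / 4]; the
     remaining [N^(2E)] is matched with [(tau * D)^E]. *)
  have -> : c / (4 * 64 ^+ E) * N ^+ (E + E).+1 = N / 4 * (c * (N ^+ 2 / 64) ^+ E).
    rewrite exprMn exprVn exprS exprD expr2 exprMn; field.
    by rewrite expf_neq0 ?pnatr_eq0.
  rewrite -[leRHS]mulrA -[c * tau ^+ E * _]mulrA -exprMn.
  have NN : N / 4 <= n / 2 by lra.
  have N0 : 0 <= N by [].
  have X0 : 0 <= N ^+ 2 / 64 by rewrite divr_ge0 ?exprn_ge0.
  apply: ler_pM => //; rewrite ?divr_ge0 ?mulr_ge0 ?exprn_ge0 ?(ltW c0) //.
  by rewrite ler_wpM2l ?(ltW c0) // lerXn2r ?nnegrE ?(le_trans X0).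
Qed.

Lemma exists_squeezed (R : realType) (k : nat) :
  exists c : R, [/\ 0 < c, c <= 1 & forall (f : R -> R) (A T : seq R),
    difference_convex k f -> uniq A -> addsub_sub A T -> squeezed k c f A T].
Proof.
elim: k => [|k [c [c0 c1 IH]]].
  (* For [k = 0] the exponents are 1 and 0, and [S = f(A)] works since [f] is injective. *)
  exists 1; split=> // f A T [mf _] uA _; exists (map f A); split.
  - rewrite map_inj_in_uniq // => x y _ _ fxy; case: mf => mf;
      by have [/mf|/mf|//] := ltgtP x y; rewrite fxy ltxx.
  - by move=> _ /mapP[a aA ->]; apply: in_sumdiff_self.
  - by move=> _ /mapP[a aA ->]; split; exists a.
  - by rewrite size_map expr1 expr0 mul1r mulr1.
exists (c / (4 * 64 ^+ (2 ^ k.+1 - 1))); split.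
- by rewrite divr_gt0 ?mulr_gt0 ?exprn_gt0.
- rewrite ler_pdivrMr ?mulr_gt0 ?exprn_gt0 // mul1r.
  by apply: le_trans c1 _; rewrite mulr_ege1 ?exprn_ege1 // ler1n.
move=> f A T df uA AT.
case: (df.1) => mf; first by apply: squeezed_step => // g B; apply: IH.
apply: squeezedN; apply: squeezed_step => //.
- by move=> g B; apply: IH.
- exact: difference_convexN.
by move=> x y /mf; rewrite ltrN2.
Qed.

(** * Passage to finite sets and conclusion *)

Lemma seq_fsub_val (K : choiceType) (X : {fset K}) (xs : seq K) :
  {subset xs <= X} -> exists zs : seq X, map val zs = xs.
Proof.
elim: xs => [|x xs IH] xsX; first by exists [::].
have [|zs zsE] := IH; first by move=> y ys; apply: xsX; rewrite inE ys orbT.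
have xX : x \in X by apply: xsX; rewrite inE eqxx.
by exists ([` xX]%fset :: zs); rewrite /= zsE.
Qed.

(** [sumdiff] ranges over tuples in the subtype of the image, so the values of [f] are first lifted
    to it. *)
Lemma in_sumdiffP (R : realType) (m n : nat) (f : R -> R) (A : {fset R}) (s : R) :
  in_sumdiff m n f A s -> s \in sumdiff m n [fset f a | a in A]%fset.
Proof.
move=> [xs [ys [sx sy hx hy ->]]].
have sub (l : seq R) : {subset l <= A} -> {subset map f l <= [fset f a | a in A]%fset}.
  by move=> lA _ /mapP[a /lA aA ->]; apply: in_imfset.
have [xz xzE] := seq_fsub_val _ _ _ (sub _ hx).
have [yz yzE] := seq_fsub_val _ _ _ (sub _ hy).
have sxz : size xz == m by rewrite -(size_map val) xzE size_map sx.
have syz : size yz == n by rewrite -(size_map val) yzE size_map sy.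
apply/imfset2P; exists (Tuple sxz) => //; exists (Tuple syz) => //=.
have sumE (zs : seq [fset f a | a in A]%fset) :
    \sum_(z <- zs) val z = \sum_(z <- map val zs) z by rewrite big_map.
by rewrite !sumE xzE yzE !big_map.
Qed.

Lemma addsub_sub_addsub (R : realType) (A : {fset R}) : addsub_sub A (addsub A).
Proof.
move=> a b d aA bA dA; apply/imfset2P; exists (a + b); last by exists d.
by apply/imfset2P; exists a => //; exists b.
Qed.

Theorem theorem1p2 (R : realType) (k : nat) (hk : (1 <= k)%N) :
  exists c : R, 0 < c /\
    forall (A : {fset R}) (f : R -> R) (K : R),
      k_convex k f ->
      0 < K ->
      (#|` addsub A|)%:R <= K * (#|` A|)%:R ->
      let fA := [fset f a | a in A]%fset in
      let N : R := (#|` A|)%:R in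
      let D : R := (#|` addsub A|)%:R in
      c * (N ^+ (2 ^ k.+1 - 1) / D ^+ (2 ^ k.+1 - k - 2))
        <= (#|` sumdiff (2 ^ k) (2 ^ k - 1) fA|)%:R /\
      N ^+ k.+1 * K ^- (2 ^ k.+1 - k - 2)
        <= N ^+ (2 ^ k.+1 - 1) / D ^+ (2 ^ k.+1 - k - 2).
Proof.
have [c [c0 _ growth]] := exists_squeezed R k; exists c; split=> //.
move=> A f K [[df _] mf] K0 DKN fA N D.
(* For empty [A] the powers of [N] have positive exponents and vanish, so both bounds are
   trivial. *)
have [N0|N_gt0] := posnP #|` A|.
  have e0 : (0 < 2 ^ k.+1 - 1)%N by rewrite subn_gt0 -[1%N](expn0 2) ltn_exp2l.
  by rewrite /N N0 !expr0n (gtn_eqF e0) /= !mul0r mulr0.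
have N0 : 0 < N by rewrite ltr0n.
have D0 : 0 < D.
  rewrite ltr0n cardfs_gt0; have /fset0Pn[a aA] : A != fset0 by rewrite -cardfs_gt0.
  by apply/fset0Pn; exists (a + a - a); apply: addsub_sub_addsub.
have k2 : (k + 2 <= 2 ^ k.+1)%N by rewrite addn2; exact: (@ltn_expl 2 k.+1 isT).
split; last first.
  (* After cancelling [N^(k+1)], what remains is [K^(-F) <= (N / D)^F] with [F = 2^(k+1) - k - 2], a
     power of [D <= K * N]. *)
  have -> : (2 ^ k.+1 - 1 = k.+1 + (2 ^ k.+1 - k - 2))%N by clear -k2; lia.
  rewrite exprD -mulrA ler_wpM2l ?exprn_ge0 ?(ltW N0) //.
  rewrite ler_pdivlMr ?exprn_gt0 // mulrC ler_pdivrMr ?exprn_gt0 //.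
  by rewrite -exprMn mulrC lerXn2r ?nnegrE ?mulr_ge0 ?(ltW D0) ?(ltW K0) ?(ltW N0).
have [S [uS hS _ cS]] := growth f A (addsub A)
  (difference_convex_derivable _ _ _ df mf) (fset_uniq A) (addsub_sub_addsub _ A).
rewrite mulrA ler_pdivrMr ?exprn_gt0 // (le_trans cS) //.
rewrite ler_wpM2r ?exprn_ge0 ?(ltW D0) // ler_nat uniq_leq_size // => s /hS.
exact: in_sumdiffP.
Qed.
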